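(* GESs are strictly less expressive than RCESs: for every GES $\gamma$ there is an RCES transition equivalent to $\gamma$, and there is an RCES that is not transition equivalent to any GES.
   Context: A GES is $\gamma=(E,\to,\mathrm{Add})$ with $E$ a set of events, $\to\subseteq E^2$, and $\mathrm{Add}\subseteq E^3$ such that $(a,c,t)\in\mathrm{Add}$ implies $\neg(c\to t)$ and $a\notin\{c,t\}$. Let $\mathrm{ic}(e)=\{e'\mid e'\to e\}$ and $\mathrm{ac}(H,e)=\{e'\mid\exists a\in H.(a,e',e)\in\mathrm{Add}\}$. $X\mapsto_\gamma Y$ iff (1) $X\subsetneq Y$, (2) $\mathrm{ic}(e)\cup\mathrm{ac}(X,e)\subseteq X$ for all $e\in Y\setminus X$, (3) for all $t,a\in Y\setminus X$ and $c\in E$, $(a,c,t)\in\mathrm{Add}$ implies $c\in X$. $\mathcal C(\gamma)$ is the set of finite $X$ with $\emptyset\mapsto_\gamma^*X$. An RCES is $\rho=(E,\vdash)$ with $\vdash\subseteq\mathcal P(E)^2$; $X\mapsto_\rho Y$ iff $X\subsetneq Y$ and for every $Z\subseteq Y$ there is $W\subseteq X$ with $W\vdash Z$; $\mathcal C(\rho)$ is the set of finite $X$ with $\emptyset\mapsto_\rho^*X$. Two structures $\mu_1,\mu_2$ are transition equivalent if $\mathcal C(\mu_1)=\mathcal C(\mu_2)$ and $\mapsto_{\mu_1}\cap\,\mathcal C(\mu_1)^2=\mapsto_{\mu_2}\cap\,\mathcal C(\mu_2)^2$. *)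

(* Defs.v *)
From mathcomp Require Import all_boot.
From mathcomp Require Import boolp classical_sets cardinality.
From Stdlib Require Import Relation_Operators.

Set Implicit Arguments.
Unset Strict Implicit.
Unset Printing Implicit Defensive.

Local Open Scope classical_set_scope.

(* Events are drawn from an ambient type [U], and each structure carries its
   own event set as a subset of [U].  Structures with different event sets
   therefore have configurations of the same type, [set U], and can be
   compared for transition equivalence. *)

Section Steps.
Variable U : Type.

Definition configurations (step : set U -> set U -> Prop) : set (set U) :=
  [set X | finite_set X /\ clos_refl_trans (set U) step set0 X].

Definition config_transitions (step : set U -> set U -> Prop) :
    set (set U * set U) :=
  [set XY | step XY.1 XY.2] `&`
  (configurations step `*` configurations step).

Definition transition_equivalent (step1 step2 : set U -> set U -> Prop) :=
  configurations step1 = configurations step2 /\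
  config_transitions step1 = config_transitions step2.

End Steps.

Record ges (U : Type) := Ges {
  ges_event : set U;
  ges_cause : U -> U -> Prop;
  ges_add : U -> U -> U -> Prop;
  ges_cause_event : forall e' e,
    ges_cause e' e -> ges_event e' /\ ges_event e;
  ges_add_event : forall a c t,
    ges_add a c t -> [/\ ges_event a, ges_event c & ges_event t];
  ges_add_axiom : forall a c t,
    ges_add a c t -> [/\ ~ ges_cause c t, a <> c & a <> t]
}.

Section GES.
Variables (U : Type) (g : ges U).

Definition ges_ic (e : U) : set U := [set e' | ges_cause g e' e].

Definition ges_ac (H : set U) (e : U) : set U :=
  [set e' | exists2 a, H a & ges_add g a e' e].

Definition ges_step (X Y : set U) : Prop :=
  [/\ Y `<=` ges_event g,
      X `<` Y,
      forall e, (Y `\` X) e -> ges_ic e `|` ges_ac X e `<=` X &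
      forall t a c, (Y `\` X) t -> (Y `\` X) a -> ges_event g c ->
        ges_add g a c t -> X c].

End GES.

Record rces (U : Type) := Rces {
  rces_event : set U;
  rces_enables : set U -> set U -> Prop;
  rces_enables_event : forall W Z,
    rces_enables W Z -> W `<=` rces_event /\ Z `<=` rces_event
}.

Definition rces_step (U : Type) (r : rces U) (X Y : set U) : Prop :=
  [/\ Y `<=` rces_event r,
      X `<` Y &
      forall Z, Z `<=` Y -> exists2 W, W `<=` X & rces_enables r W Z].

(* Main.v *)
(** In a GES a step may be postponed: if [X ↦ Y] and [X ⊆ X' ⊊ Y]
    then [X' ↦ Y], because the causes added by the events of [X' \ X] already lie
    in [X] by condition (3).  Hence the enabling relation "conditions (2) and (3)
    hold for [(W, Z)]" gives an RCES with literally the same steps.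

    Conversely, a GES cannot express the resolvable conflict in which [a] and [b]
    may occur in either order but not simultaneously: the simultaneous step could
    only be blocked by some [(a, c, b)] in [Add] (or its mirror image), and then the
    step adding [b] to [{a}] forces [c = a], which the axiom on [Add] forbids. *)
Require Import Defs.
From mathcomp Require Import all_boot.
From mathcomp Require Import boolp classical_sets cardinality.
From Stdlib Require Import Relation_Operators.

Local Open Scope classical_set_scope.

Section TransitionEquivalence.
Variable U : Type.
Implicit Types (s : set U -> set U -> Prop) (X Y : set U).

Lemma eq_step_transition_equivalent s1 s2 :
  (forall X Y, s1 X Y <-> s2 X Y) -> transition_equivalent s1 s2.
Proof.
move=> s12; have -> : s1 = s2 by apply/funext => X; apply/funext => Y; apply/propext.
by split.
Qed.

(** Transition equivalence compares steps between configurations only, so both endpoints must be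
    known to be reachable and finite. *)
Lemma transition_equivalent_step s1 s2 X Y :
  transition_equivalent s1 s2 -> configurations s1 X -> configurations s1 Y ->
  s1 X Y <-> s2 X Y.
Proof.
move=> [eqC eqT] CX CY; split=> sXY.
- by have : config_transitions s1 (X, Y) by []; rewrite eqT => -[].
- have : config_transitions s2 (X, Y) by split=> //; rewrite -eqC.
  by rewrite -eqT => -[].
Qed.

Lemma configurations_set0 s : configurations s set0.
Proof. by split; [exact: finite_set0 | exact: rt_refl]. Qed.

Lemma configurations_step s X Y :
  configurations s X -> s X Y -> finite_set Y -> configurations s Y.
Proof. by move=> [_ sX] sXY finY; split=> //; apply: rt_trans sX (rt_step _ _ _ _ sXY). Qed.

End TransitionEquivalence.

Section RcesOfGes.
Variables (U : Type) (g : ges U).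
Implicit Types W X Y Z : set U.

(** [W] need not lie inside [Z]: the subsets [Z] of [Y] that an RCES step from [X] must enable
    include some that miss part of [X]. *)
Definition ges_enables W Z : Prop :=
  [/\ W `<=` ges_event g, Z `<=` ges_event g,
      forall e, (Z `\` W) e -> ges_ic g e `|` ges_ac g W e `<=` W &
      forall t a c, (Z `\` W) t -> (Z `\` W) a -> ges_add g a c t -> W c].

Lemma ges_enables_event W Z :
  ges_enables W Z -> W `<=` ges_event g /\ Z `<=` ges_event g.
Proof. by case. Qed.

Definition rces_of_ges : rces U := Rces ges_enables_event.

Lemma ges_enables_mono W X Y :
  W `<=` X -> X `<=` Y -> ges_enables W Y -> ges_enables X Y.
Proof.
move=> WX XY [_ YE ic_ac add].
have sub e : (Y `\` X) e -> (Y `\` W) e by move=> [Ye nXe]; split=> // /WX.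
split=> //; first exact: subset_trans YE.
- move=> e YXe c [icc | [a Xa addc]].
    by apply: WX; apply: (ic_ac e); [exact: sub | left].
  (* If [a] is in [W], condition (2) at [W] already demands [c]. Otherwise [a] and [e] are both new
     relative to [W], and condition (3) puts [c] in [W]. *)
  have [Wa | nWa] := pselect (W a).
    by apply: WX; apply: (ic_ac e); [exact: sub | right; exists a].
  by apply: WX; apply: (add e a c) => //; [exact: sub | split=> //; exact: XY].
- by move=> t a c /sub YWt /sub YWa addc; apply: WX; apply: add addc.
Qed.

Lemma rces_of_ges_step X Y : ges_step g X Y <-> rces_step rces_of_ges X Y.
Proof.
split=> [[YE XY ic_ac add] | [YE XY en]].
- split=> // Z ZY; exists X => //.
  have sub e : (Z `\` X) e -> (Y `\` X) e by move=> [/ZY].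
  split=> //.
  + exact: subset_trans (properW XY) YE.
  + exact: subset_trans ZY YE.
  + by move=> e /sub; exact: ic_ac.
  + move=> t a c /sub Yt /sub Ya addc; apply: add (addc) => //.
    by have [] := ges_add_event addc.
(* The instance [Z = Y] suffices: its enabling set [W] can be enlarged to [X]. *)
- have [W WX /(ges_enables_mono _ _ _ WX (properW XY)) [_ _ ic_ac add]] := en Y (@subset_refl _ Y).
  by split=> // t a c Yt Ya _; exact: add.
Qed.

End RcesOfGes.

Lemma ges_step_add_cause (U : Type) (g : ges U) (X Y : set U) (a b c : U) :
  ges_step g (X `|` [set a]) Y -> Y b -> ~ X b -> ges_add g a c b -> X c.
Proof.
move=> [_ _ ic_ac _] Yb nXb addc; have [_ ac ab] := ges_add_axiom addc.
have : (X `|` [set a]) c.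
  apply: (ic_ac b); last by right; exists a => //; right.
  by split=> // -[//|ba]; apply: ab.
by case=> // ca; case: ac.
Qed.

(** Condition (2) is inherited from the two single steps out of [X]; condition (3) comes from the
    later steps, where the adder has already occurred. *)
Lemma ges_step_join (U : Type) (g : ges U) (X : set U) (a b : U) :
  ges_step g X (X `|` [set a]) -> ges_step g X (X `|` [set b]) ->
  ges_step g (X `|` [set a]) (X `|` [set a; b]) ->
  ges_step g (X `|` [set b]) (X `|` [set a; b]) ->
  ges_step g X (X `|` [set a; b]).
Proof.
move=> [_ [_ nXa] ica _] [_ _ icb _] sa sb; have [abE _ _ _] := sa.
split=> //.
- split=> [x Xx|abX]; first by left.
  by apply: nXa => x [Xx|xa]; apply: abX; [left | right; left].
- by move=> e [[//|[]->] nXe]; [apply: ica | apply: icb]; split=> //; right.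
- move=> t d c [Yt nXt] [[//|dab] nXd] _ addc.
  by case: dab addc => -> addc; [apply: ges_step_add_cause sa Yt nXt addc |
                                 apply: ges_step_add_cause sb Yt nXt addc].
Qed.

Section ResolvableConflict.
Variables (U : Type) (a b : U).
Implicit Types W X Y Z : set U.

Definition conflict_enables W Z : Prop :=
  [/\ W `<=` [set a; b], Z `<=` [set a; b] & Z = [set a; b] -> W !=set0].

Lemma conflict_enables_event W Z :
  conflict_enables W Z -> W `<=` [set a; b] /\ Z `<=` [set a; b].
Proof. by case. Qed.

Definition rces_conflict : rces U := Rces conflict_enables_event.

Lemma rces_conflict_step X Y :
  rces_step rces_conflict X Y <->
  [/\ Y `<=` [set a; b], X `<` Y & Y = [set a; b] -> X !=set0].
Proof.
split=> [[YE XY en] | [YE XY ne]].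
  split=> // Yab; have [W WX [_ _ /(_ Yab)[w Ww]]] := en Y (@subset_refl _ Y).
  by exists w; apply: WX.
split=> // Z ZY; exists X => //; split.
- exact: subset_trans (properW XY) YE.
- exact: subset_trans ZY YE.
(* If [Z] is the whole pair, so is [Y], being squeezed between [Z] and the pair. *)
- by move=> Zab; apply: ne; rewrite eqEsubset -{2}Zab.
Qed.

Lemma rces_conflict_not_ges (g : ges U) :
  a <> b -> ~ transition_equivalent (rces_step rces_conflict) (ges_step g).
Proof.
move=> ab eqv; set s := rces_step rces_conflict in eqv.
have aab : [set a; b] a by left.
have bab : [set a; b] b by right.
have s1 x : [set a; b] x -> s set0 [set x].
  move=> abx; apply/rces_conflict_step; split=> [_ ->//||xab].
    by split=> // /(_ x erefl).
  (* A singleton equal to the pair would identify [a] with [b]. *)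
  have eqx y : [set a; b] y -> y = x by rewrite -xab.
  by case: ab; rewrite (eqx a aab) (eqx b bab).
have s2 x : [set a; b] x -> s [set x] [set a; b].
  move=> abx; apply/rces_conflict_step; split=> //; last by exists x.
  split=> [_ ->//|abX]; apply: ab.
  by rewrite (abX a aab) (abX b bab).
have C0 := configurations_set0 U s.
have C1 x : [set a; b] x -> configurations s [set x].
  by move=> abx; apply: configurations_step C0 (s1 _ abx) (finite_set1 x).
have Cab : configurations s [set a; b].
  exact: configurations_step (C1 _ aab) (s2 _ aab) (finite_set2 a b).
have toges X Y : configurations s X -> configurations s Y -> s X Y -> ges_step g X Y.
  by move=> CX CY /(transition_equivalent_step _ _ _ _ _ eqv CX CY).
(* The unions with [set0] match the shape of [ges_step_join] at [X = set0]. *)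
have : ges_step g (set0 `|` [set a]) (set0 `|` [set a; b]).
  by rewrite !set0U; apply: toges; auto.
have : ges_step g (set0 `|` [set b]) (set0 `|` [set a; b]).
  by rewrite !set0U; apply: toges; auto.
have : ges_step g set0 (set0 `|` [set b]) by rewrite set0U; apply: toges; auto.
have : ges_step g set0 (set0 `|` [set a]) by rewrite set0U; apply: toges; auto.
move=> ga gb gba gab; have := ges_step_join _ _ _ _ _ ga gb gab gba.
(* Carried back to the RCES, the joint step would need [set0] to be nonempty. *)
rewrite set0U => /(transition_equivalent_step _ _ _ _ _ eqv C0 Cab).
by move=> /rces_conflict_step[_ _ /(_ erefl)[]].
Qed.

End ResolvableConflict.

(** Supplies the two conflicting events: without a distinct pair, [U] is empty or a singleton. *)
Lemma infinite_setT_neq (U : Type) :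
  infinite_set [set: U] -> exists a b : U, a <> b.
Proof.
move=> infU; apply: contrapT => nab; apply: infU.
have [[a _]|/nonemptyPn ->] := pselect ([set: U] !=set0); last exact: finite_set0.
apply: sub_finite_set (finite_set1 a) => b _ /=.
by apply: contrapT => ba; apply: nab; exists b, a.
Qed.

Theorem theorem5p14 (U : Type) :
  (forall g : ges U, exists r : rces U,
     transition_equivalent (ges_step g) (rces_step r)) /\
  (infinite_set [set: U] -> exists r : rces U, forall g : ges U,
     ~ transition_equivalent (rces_step r) (ges_step g)).
Proof.
split=> [g|/infinite_setT_neq [a [b ab]]].
  exists (rces_of_ges U g); apply: eq_step_transition_equivalent => X Y.
  exact: rces_of_ges_step.
by exists (rces_conflict U a b) => g; apply: rces_conflict_not_ges.
Qed.
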